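(* Let $k\ge 4$ be an even positive integer. Let $n$ be an odd positive integer that is a $\frac{k}{2}$-layered number with $\frac{k}{2}$-layered partition $\{A'_1,A'_2,\dots,A'_{\frac{k}{2}}\}$. Let $\alpha$ be a positive integer and put $A''_i=\{2^{\alpha}d : d\in A'_i\}$ for every integer $1\le i\le\frac{k}{2}$. Suppose that $m=2^{\alpha}n$ is a $k$-layered number with a $k$-layered partition $\{A_1,A_2,\dots,A_k\}$ such that $A''_i\subset A_{2i-1}\cup A_{2i}$ for every integer $1\le i\le\frac{k}{2}$. Then $m$ is a good $k$-layered number.
   Context: For a positive integer $j$, a positive integer $n$ is $j$-layered if the set of all positive divisors of $n$ can be partitioned into $j$ subsets $A_1,\dots,A_j$ having the same sum of elements; such a partition $\{A_1,\dots,A_j\}$ is called a $j$-layered partition for $n$. An even $k$-layered number $n$ is called a good $k$-layered number if $2^{\beta}n$ is $k$-layered for every positive integer $\beta$. *)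

(* Defs.v *)
From mathcomp Require Import all_boot.
From mathcomp Require Import finmap.

Set Implicit Arguments.
Unset Strict Implicit.
Unset Printing Implicit Defensive.

Local Open Scope fset_scope.
Local Open Scope nat_scope.

(* The ordered list of parts A_1, ..., A_j is encoded by A : nat -> {fset nat};
   only the values A i with 1 <= i <= j matter. [divisors n] lists the positive
   divisors of n only for n > 0. *)
Definition layered_partition (j n : nat) (A : nat -> {fset nat}) : Prop :=
  [/\ forall i, 1 <= i <= j -> A i != fset0,
      forall i1 i2, 1 <= i1 <= j -> 1 <= i2 <= j -> i1 != i2 ->
        [disjoint A i1 & A i2]%fset,
      (\bigcup_(i <- iota 1 j) A i)%fset = [fset d in divisors n] &
      forall i1 i2, 1 <= i1 <= j -> 1 <= i2 <= j ->
        \sum_(d <- A i1) d = \sum_(d <- A i2) d].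

Definition layered (j n : nat) : Prop :=
  [/\ 0 < j, 0 < n & exists A : nat -> {fset nat}, layered_partition j n A].

Definition good_layered (k n : nat) : Prop :=
  [/\ ~~ odd n, layered k n &
      forall beta : nat, 0 < beta -> layered k (2 ^ beta * n)].

(* Main.v *)
(* Write Z_i = 2^alpha A'_i, which has the same sum for every i.
   From each part A_j of the pair containing Z_i, double the elements of
   Z_i :&: A_j and take over the elements of Z_i lying in the other part of the
   pair.  The sum of A_j then grows by sum (Z_i :&: A_j) + sum (Z_i :\: A_j) =
   sum Z_i, the sets 2 Z_i partition the divisors of 2^alpha.+1 n that do not
   divide 2^alpha n, and 2 Z_i again lies in the new pair, so the step iterates. *)
Require Import Defs.
From mathcomp Require Import all_boot.
From mathcomp Require Import finmap.
From mathcomp Require Import zify.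

Local Open Scope fset_scope.
Local Open Scope nat_scope.

Section LayeredPartition.
Variables (j n : nat) (A : nat -> {fset nat}).
Hypotheses (n_gt0 : 0 < n) (A_part : layered_partition j n A).

Lemma layered_partition_mem d :
  reflect (exists2 i, 1 <= i <= j & d \in A i) (d %| n).
Proof.
case: A_part => _ _ A_cover _.
have -> : (d %| n) = (d \in (\bigcup_(i <- iota 1 j) A i)%fset).
  by rewrite A_cover !inE -dvdn_divisors.
apply: (iffP (bigfcupP _ _ _ _)) => -[i].
  by rewrite andbT mem_iota => Hi Ai; exists i => //; lia.
by move=> Hi Ai; exists i => //; rewrite andbT mem_iota; lia.
Qed.

Lemma layered_partition_inj d i1 i2 : 1 <= i1 <= j -> 1 <= i2 <= j ->
  d \in A i1 -> d \in A i2 -> i1 = i2.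
Proof.
case: A_part => _ A_disj _ _ Hi1 Hi2 d1 d2.
apply/eqP; apply/negPn/negP => /(A_disj _ _ Hi1 Hi2)/fdisjointP/(_ d d1).
by rewrite d2.
Qed.

End LayeredPartition.

Lemma sum_fsetU (X Y : {fset nat}) : [disjoint X & Y]%fset ->
  \sum_(d <- (X `|` Y)%fset) d = \sum_(d <- X) d + \sum_(d <- Y) d.
Proof.
move=> /fdisjointP XY; rewrite (big_fsetID _ (mem X)) /=.
by congr addn; apply: eq_fbigl => x; rewrite !inE /=;
  case: (boolP (x \in X)) => [/XY/negPf ->|_] //=; rewrite ?andbT ?andbF.
Qed.

Lemma sum_fset_scale c (Z : {fset nat}) : 0 < c ->
  \sum_(d <- [fset c * z | z in Z]%fset) d = c * \sum_(d <- Z) d.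
Proof.
move=> c_gt0; rewrite big_imfset /= ?big_distrr //.
by move=> x y _ _ /eqP; rewrite eqn_pmul2l // => /eqP.
Qed.

(** The first two terms form the symmetric difference of [B] and [Z]. When [Z] lies in the union of
    two disjoint parts, applying this to both parts swaps their elements of [Z], while the doubles
    stay with the part that held the originals. *)
Definition absorb (Z B : {fset nat}) : {fset nat} :=
  (((B `\` Z) `|` (Z `\` B)) `|` [fset 2 * z | z in Z `&` B])%fset.

Lemma absorbP (Z B : {fset nat}) x :
  reflect ((x \in B) != (x \in Z) \/
           exists z, [/\ z \in Z, z \in B & x = 2 * z])
          (x \in absorb Z B).
Proof.
rewrite /absorb 2!in_fsetU !in_fsetD.
have -> : (x \notin Z) && (x \in B) || (x \notin B) && (x \in Z)
          = ((x \in B) != (x \in Z)) by case: (x \in B); case: (x \in Z).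
apply: (iffP orP) => -[->|]; try by left.
  by move/imfsetP => /= [z]; rewrite in_fsetI => /andP[zZ zB] ->; right; exists z.
move=> [z [zZ zB ->]]; right; apply/imfsetP; exists z => //=.
by rewrite in_fsetI zZ.
Qed.

(** The hypotheses keep the doubles apart from the symmetric difference, so the sum is that of [B]
    minus [Z], plus [Z] minus [B], plus twice the intersection; one copy of the intersection
    completes [B], the other completes [Z]. *)
Lemma sum_absorb (Z B : {fset nat}) :
  (forall z, z \in Z -> 2 * z \notin B) ->
  (forall z, z \in Z -> 2 * z \notin Z) ->
  \sum_(d <- absorb Z B) d = \sum_(d <- B) d + \sum_(d <- Z) d.
Proof.
move=> ZB ZZ.
rewrite /absorb sum_fsetU; last first.
  apply/fdisjointP => x; rewrite in_fsetU !in_fsetD => Hx.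
  apply/negP => /imfsetP /= [z]; rewrite in_fsetI => /andP[zZ zB] E.
  by move: Hx; rewrite E (negPf (ZB _ zZ)) (negPf (ZZ _ zZ)).
rewrite sum_fsetU; last first.
  by apply/fdisjointP => x; rewrite !in_fsetD; case: (x \in Z); case: (x \in B).
rewrite sum_fset_scale //.
have split_sum (X Y : {fset nat}) :
    \sum_(d <- X) d = \sum_(d <- (X `&` Y)%fset) d + \sum_(d <- (X `\` Y)%fset) d.
  rewrite -{1}(fsetID Y X) sum_fsetU //.
  by apply/fdisjointP => x; rewrite in_fsetI in_fsetD; case: (x \in Y); case: (x \in X).
rewrite (split_sum B Z) (split_sum Z B) fsetIC; lia.
Qed.

(** Write [x] as [d * 2 ^ e] with [d] odd. The first divisibility gives [d %| n] and [e <= a.+1];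
    its failure at exponent [a] forces [a < e]. *)
Lemma dvdn_expS_new a n x : 0 < n -> odd n ->
  x %| 2 ^ a.+1 * n -> ~~ (x %| 2 ^ a * n) ->
  exists2 d, d %| n & x = 2 * (2 ^ a * d).
Proof.
move=> n_gt0 n_odd x_dvd x_new.
have x_gt0 : 0 < x by apply: dvdn_gt0 x_dvd; rewrite muln_gt0 expn_gt0.
have [d co_d xE] := pfactor_coprime (isT : prime 2) x_gt0; set e := logn 2 x in xE.
have d_n : d %| n.
  rewrite -(@Gauss_dvdr _ (2 ^ a.+1)); first by rewrite (dvdn_trans _ x_dvd) // xE dvdn_mulr.
  by rewrite coprime_sym coprimeXl.
have e_le : e <= a.+1.
  rewrite -(@dvdn_Pexp2l 2) // -(@Gauss_dvdl _ _ n) ?coprimeXl ?coprime2n //.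
  by rewrite (dvdn_trans _ x_dvd) // xE dvdn_mull.
have e_gt : a < e.
  rewrite ltnNge; apply: contra x_new => e_a.
  by rewrite xE mulnC dvdn_mul // dvdn_exp2l.
exists d => //; rewrite mulnA -expnS mulnC xE.
by have -> : e = a.+1 by lia.
Qed.

Section Doubling.
Variables (k n alpha : nat) (A' A : nat -> {fset nat}).
Hypotheses (k_even : ~~ odd k) (n_gt0 : 0 < n) (n_odd : odd n).
Hypothesis A'_part : layered_partition k./2 n A'.
Hypothesis A_part : layered_partition k (2 ^ alpha * n) A.

Let Z i := [fset (2 ^ alpha * d)%N | d in A' i]%fset.
Hypothesis Z_sub : forall i, 1 <= i <= k./2 ->
  (Z i `<=` A (2 * i - 1)%N `|` A (2 * i)%N)%fset.

(** The indices [2 * i - 1] and [2 * i] both have [uphalf] equal to [i], so [uphalf j] numbers the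
    pair containing [A j]. *)
Let C j := absorb (Z (uphalf j)) (A j).

Let m_gt0 : 0 < 2 ^ alpha * n. Proof. by rewrite muln_gt0 expn_gt0. Qed.

Let Z_dvd i z : 1 <= i <= k./2 -> z \in Z i -> z %| 2 ^ alpha * n.
Proof.
move=> Hi /imfsetP /= [d dA ->]; rewrite dvdn_pmul2l ?expn_gt0 //.
by apply/(layered_partition_mem _ _ _ n_gt0 A'_part); exists i.
Qed.

(** Cancelling [2 ^ alpha] would leave [2 * d %| n] with [n] odd. *)
Let double_ndvd i z : z \in Z i -> ~~ (2 * z %| 2 ^ alpha * n).
Proof.
move=> /imfsetP /= [d dA ->]; rewrite mulnCA dvdn_pmul2l ?expn_gt0 //.
apply/negP => /(dvdn_trans (dvdn_mulr d (dvdnn 2))).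
by rewrite dvdn2 n_odd.
Qed.

Let Z_part i z : 1 <= i <= k./2 -> z \in Z i ->
  exists2 j, 1 <= j <= k & z \in A j /\ uphalf j = i.
Proof.
move=> Hi /(fsubsetP (Z_sub _ Hi)); rewrite in_fsetU => /orP[] zA.
  by exists (2 * i - 1); [lia | split=> //; lia].
by exists (2 * i); [lia | split=> //; lia].
Qed.

Let uphalf_bound j : 1 <= j <= k -> 1 <= uphalf j <= k./2.
Proof. lia. Qed.

Lemma double_layered_partition : layered_partition k (2 ^ alpha.+1 * n) C.
Proof.
have [A_n0 A_disj A_cover A_sum] := A_part.
have memA := layered_partition_mem _ _ _ m_gt0 A_part.
have injA := layered_partition_inj _ _ _ A_part.
have A_dvd j x : 1 <= j <= k -> x \in A j -> x %| 2 ^ alpha * n.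
  by move=> Hj xA; apply/memA; exists j.
have old j x : 1 <= j <= k -> (x \in A j) != (x \in Z (uphalf j)) ->
    x %| 2 ^ alpha * n.
  move=> Hj; case xA: (x \in A j); first by move: xA => /(A_dvd _ _ Hj).
  by case xZ: (x \in Z _) => // _; apply: Z_dvd (uphalf_bound _ Hj) xZ.
(* An undoubled element of [C j] comes from [A j] or from its partner, so swapping never leaves the
   pair. *)
have old_part j x j0 : 1 <= j <= k -> (x \in A j) != (x \in Z (uphalf j)) ->
    1 <= j0 <= k -> x \in A j0 -> uphalf j0 = uphalf j.
  move=> Hj + Hj0 xA0; case xA: (x \in A j); first by rewrite (injA _ _ _ Hj0 Hj xA0 xA).
  case xZ: (x \in Z _) => // _.
  have [j1 Hj1 [xA1 <-]] := Z_part _ _ (uphalf_bound _ Hj) xZ.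
  by rewrite (injA _ _ _ Hj0 Hj1 xA0 xA1).
(* If [x] is in [A j0], both indices lie in the pair of [j0]. Membership of [x] in [Z] then decides:
   if it holds, both are the partner of [j0]; otherwise both are [j0]. *)
have old_inj j1 j2 x : 1 <= j1 <= k -> 1 <= j2 <= k ->
    (x \in A j1) != (x \in Z (uphalf j1)) ->
    (x \in A j2) != (x \in Z (uphalf j2)) -> j1 = j2.
  move=> H1 H2 x1 x2; have /memA[j0 H0 x0] := old _ _ H1 x1.
  have e1 := old_part _ _ _ H1 x1 H0 x0; have e2 := old_part _ _ _ H2 x2 H0 x0.
  have AE j : 1 <= j <= k -> (x \in A j) = (j == j0).
    move=> Hj; apply/idP/eqP => [xj|->//]; exact: injA Hj H0 xj x0.
  move: x1 x2; rewrite !AE // -e1 -e2.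
  case: (x \in Z _); lia.
have C_new j z : 1 <= j <= k -> z \in A j -> z \in Z (uphalf j) -> 2 * z \in C j.
  by move=> Hj zA zZ; apply/absorbP; right; exists z.
split.
- move=> j Hj; have /fset0Pn[x xA] := A_n0 j Hj; apply/fset0Pn.
  case xZ: (x \in Z (uphalf j)); first by exists (2 * x); apply: C_new.
  by exists x; apply/absorbP; left; rewrite xA xZ.
- move=> j1 j2 H1 H2 /eqP ne; apply/fdisjointP => x /absorbP x1.
  apply/negP => /absorbP x2; apply: ne.
  (* The mixed cases fail because undoubled elements divide [2 ^ alpha * n] and doubles do not; two
     equal doubles have the same half, which lies in only one part. *)
  case: x1 => [x1|[z1 [zZ1 zA1 xE1]]]; case: x2 => [x2|[z2 [zZ2 zA2 xE2]]].
  + exact: old_inj x1 x2.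
  + by move: (double_ndvd _ _ zZ2); rewrite -xE2 (old _ _ H1 x1).
  + by move: (double_ndvd _ _ zZ1); rewrite -xE1 (old _ _ H2 x2).
  + have zE : z1 = z2 by lia.
    by apply: injA zA1 _ => //; rewrite zE.
- apply/fsetP => x; rewrite !inE -dvdn_divisors ?muln_gt0 ?expn_gt0 //.
  apply/bigfcupP/idP => [[j]|x_dvd].
    rewrite andbT mem_iota => Hj'; have Hj : 1 <= j <= k by lia.
    rewrite expnS -mulnA => /absorbP[/(old _ _ Hj) xd|[z [zZ zA ->]]].
      exact: dvdn_mull.
    by rewrite dvdn_pmul2l // (A_dvd _ _ Hj zA).
  suff [j Hj xC] : exists2 j, 1 <= j <= k & x \in C j.
    by exists j => //; rewrite andbT mem_iota; lia.
  case: (boolP (x %| 2 ^ alpha * n)) => [/memA[j0 H0 x0]|x_new].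
    case xZ: (x \in Z (uphalf j0)); last first.
      by exists j0 => //; apply/absorbP; left; rewrite x0 xZ.
    (* The partner of [j0], which receives [x] in the swap. It stays at most [k] because [k] is
       even. *)
    pose j1 := if odd j0 then j0.+1 else j0.-1.
    have H1 : 1 <= j1 <= k by rewrite /j1; case: ifP; lia.
    have e1 : uphalf j1 = uphalf j0 by rewrite /j1; case: ifP; lia.
    exists j1 => //; apply/absorbP; left; rewrite e1 xZ.
    case x1: (x \in A j1) => //.
    have := injA _ _ _ H0 H1 x0 x1; rewrite /j1; case: ifP; lia.
  (* A new divisor is the double of an element of some [Z i], and it lands in the part that held
     that element. *)
  have [d d_n xE] := dvdn_expS_new _ _ _ n_gt0 n_odd x_dvd x_new.
  have /(layered_partition_mem _ _ _ n_gt0 A'_part)[i Hi dA] := d_n.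
  have zZ : 2 ^ alpha * d \in Z i by apply/imfsetP; exists d.
  have [j Hj [zA jE]] := Z_part _ _ Hi zZ.
  by exists j => //; rewrite xE; apply: C_new; rewrite ?jE.
(* The increment is the same for all [j], since the sets [A' i] have equal sums. *)
- have sumC j : 1 <= j <= k -> \sum_(d <- C j) d =
      \sum_(d <- A j) d + 2 ^ alpha * \sum_(d <- A' (uphalf j)) d.
    move=> Hj; rewrite sum_absorb; first by rewrite sum_fset_scale ?expn_gt0.
      by move=> z /double_ndvd; apply: contra => /(A_dvd _ _ Hj).
    by move=> z /double_ndvd; apply: contra => /(Z_dvd _ _ (uphalf_bound _ Hj)).
  have [_ _ _ A'_sum] := A'_part.
  move=> j1 j2 H1 H2; rewrite !sumC // (A_sum _ _ H1 H2).
  by rewrite (A'_sum _ _ (uphalf_bound _ H1) (uphalf_bound _ H2)).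
Qed.

(** Doubles are not swapped: if [2 ^ alpha * d] is in [A j] for an index [j] of the pair, its double
    is in [C j]. *)
Lemma double_sub i : 1 <= i <= k./2 ->
  ([fset (2 ^ alpha.+1 * d)%N | d in A' i] `<=` C (2 * i - 1)%N `|` C (2 * i)%N)%fset.
Proof.
move=> Hi; apply/fsubsetP => x /imfsetP /= [d dA ->].
have zZ : 2 ^ alpha * d \in Z i by apply/imfsetP; exists d.
have e1 : uphalf (2 * i - 1) = i by lia.
have e2 : uphalf (2 * i) = i by lia.
rewrite expnS -mulnA in_fsetU; move/fsubsetP: (Z_sub _ Hi) => /(_ _ zZ).
rewrite in_fsetU => /orP[zA|zA]; apply/orP; [left|right]; apply/absorbP; right;
  by exists (2 ^ alpha * d); rewrite ?e1 ?e2.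
Qed.

End Doubling.

Theorem theorem5p7 (k n alpha : nat) (A' A : nat -> {fset nat})
    (k_ge4 : 4 <= k) (k_even : ~~ odd k)
    (n_gt0 : 0 < n) (n_odd : odd n)
    (A'_part : layered_partition k./2 n A')
    (alpha_gt0 : 0 < alpha)
    (A_part : layered_partition k (2 ^ alpha * n) A)
    (A''_sub : forall i, 1 <= i <= k./2 ->
       ([fset (2 ^ alpha * d)%N | d in A' i] `<=` A (2 * i - 1)%N `|` A (2 * i)%N)%fset) :
  good_layered k (2 ^ alpha * n).
Proof.
have layer beta : layered k (2 ^ beta * (2 ^ alpha * n)).
  split; [lia | by rewrite !muln_gt0 !expn_gt0 | rewrite mulnA -expnD].
  (* The induction must carry the inclusion into pairs as well; [A'] stays fixed and only the power
     of 2 grows. *)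
  suff [C []] : exists C : nat -> {fset nat},
      layered_partition k (2 ^ (beta + alpha) * n) C /\
      forall i, 1 <= i <= k./2 ->
        ([fset (2 ^ (beta + alpha) * d)%N | d in A' i]
           `<=` C (2 * i - 1)%N `|` C (2 * i)%N)%fset by exists C.
  elim: beta => [|beta [C [C_part C_sub]]]; first by exists A.
  rewrite addSn; eexists; split.
    exact: (double_layered_partition _ _ _ _ _ k_even n_gt0 n_odd A'_part C_part C_sub).
  exact: (double_sub _ _ _ _ _ k_even n_gt0 n_odd C_sub).
split=> //.
  by rewrite oddM oddX /= orbF; case: alpha alpha_gt0 {A_part A''_sub layer}.
by have := layer 0; rewrite expn0 mul1n.
Qed.
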